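(* Let $0\le i<n$ and let $a$ be a weak composition with $a_i>a_{i+1}$ if $i\ge1$, and with $a_n\ge a_1>0$ if $i=0$. Then $\mathcal{E}_i(T)\in\mathrm{SSKD}(s_i\cdot a)$ for every $T\in\mathrm{SSKD}(a)$.
   Context: Fix $n\ge 2$. A weak composition is $a=(a_1,\ldots,a_n)\in\mathbb{Z}_{\ge0}^n$. For $1\le i<n$, $s_i\cdot a$ exchanges $a_i$ and $a_{i+1}$; $s_0\cdot a=(a_n+1,a_2,\ldots,a_{n-1},a_1-1)$. The diagram of $a$ has $a_r$ cells left-justified in row $r$ (row $1$ at the bottom), in columns $1,\dots,a_r$; there is also a basement column $0$ whose cell in row $r$ has entry $r$. A filling assigns an entry in $\{1,\ldots,n\}$ to each cell. A filling is non-attacking if no two cells with the same entry lie in the same column, and no two cells with the same entry lie in adjacent columns $c,c+1$ with the cell in column $c$ in a strictly higher row. A triple consists of three cells (basement allowed): two cells in row $r$ in adjacent columns $c,c+1$, and a third cell either (Type I) in column $c$ in a row $s>r$ with $a_r>a_s$, or (Type II) in column $c+1$ in a row $s<r$ with $a_r\ge a_s$ (row lengths in the shape of the filling). Entries are compared as integers (basement entry = row index), equal entries being compared by regarding the one further right as smaller. For Type I let $\alpha,\beta,\gamma$ be the entries of the lower-left, lower-right, upper cell; for Type II of the upper-left, upper-right, lower cell. It is a co-inversion triple if $\alpha<\beta<\gamma$ or $\beta<\gamma<\alpha$ or $\gamma<\alpha<\beta$. $\mathrm{SSKD}(a)$ is the set of non-attacking fillings of the diagram of $a$ with no co-inversion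 triples. $\mathcal{E}_i$ for $1\le i<n$ (when $a_i>a_{i+1}$): $\mathcal{E}_i(T)$ is a filling of the diagram of $s_i\cdot a$. For $k=0,\ldots,a_{i+1}$ let $y_k,x_k$ be the entries of $T$ in rows $i+1,i$ of column $k$ (column $0$ the basement, fixed). Inductively for $k=0,\ldots,a_{i+1}-1$: if in column $k$ of $\mathcal{E}_i(T)$ the entry $y_k$ is above $x_k$, put $y_{k+1}$ in row $i+1$ and $x_{k+1}$ in row $i$ of column $k+1$, unless this makes $y_k,y_{k+1},x_{k+1}$ (cells row $i+1$ col $k$, row $i+1$ col $k+1$, row $i$ col $k+1$) a Type II co-inversion triple, in which case put $x_{k+1}$ in row $i+1$ and $y_{k+1}$ in row $i$; otherwise ($x_k$ above $y_k$) put $x_{k+1}$ in row $i+1$ and $y_{k+1}$ in row $i$, unless this makes $x_k,x_{k+1},y_{k+1}$ a Type II co-inversion triple, in which case put $y_{k+1}$ in row $i+1$ and $x_{k+1}$ in row $i$. Entries of row $i$ of $T$ in columns $a_{i+1}+1,\ldots,a_i$ go to the same columns of row $i+1$; other rows are copied. $\mathcal{E}_0$ (when $a_n\ge a_1>0$): $\mathcal{E}_0(T)$ is a filling of the diagram of $s_0\cdot a$. Let $y_k,x_k$ be the entries of $T$ in rows $n,1$ of column $k$. Rows $2,\ldots,n-1$ are copied; row $1$, column $1$ gets $x_1$. Inductively for $k=1,\ldots,a_1-1$: if row $1$, column $k$ of $\mathcal{E}_0(T)$ contains $x_k$, put $y_k$ in row $n$ column $k$ and $x_{k+1}$ in row $1$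 column $k+1$, unless the cells (row $1$, col $k$), (row $1$, col $k+1$), (row $n$, col $k$) then form a Type I co-inversion triple or contain an attacking pair, in which case put $x_{k+1}$ in row $n$ column $k$ and $y_k$ in row $1$ column $k+1$; otherwise (row $1$ column $k$ contains $y_{k-1}$) put $x_{k+1}$ in row $n$ column $k$ and $y_k$ in row $1$ column $k+1$, unless those three cells then form a Type I co-inversion triple or contain an attacking pair, in which case put $y_k$ in row $n$ column $k$ and $x_{k+1}$ in row $1$ column $k+1$. Finally $y_{a_1},\ldots,y_{a_n}$ are placed in row $1$, columns $a_1+1,\ldots,a_n+1$. *)

(* Defs.v *)
From mathcomp Require Import all_boot.

Set Implicit Arguments.
Unset Strict Implicit.
Unset Printing Implicit Defensive.

(* Rows and entries range over 'I_n: the ordinal of value j stands for the    *)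
(* number j + 1. Columns are naturals, column 0 being the basement.           *)

Definition weak_comp (n : nat) := {ffun 'I_n -> nat}.

Section Tableaux.
Variable n : nat.
Implicit Types (a : weak_comp n).

(* Only the non-basement entries are data. *)
Definition filling a := {dffun forall r : 'I_n, (a r).-tuple 'I_n}.

Definition entry a (T : filling a) (r : 'I_n) (c : nat) : 'I_n :=
  nth r (r :: T r) c.

(* Cells of the diagram together with the basement. *)
Definition cell a := {r : 'I_n & 'I_(a r).+1}.

Record lcell := LCell { lrow : 'I_n; lcol : nat; lent : 'I_n }.
Implicit Types (p q g : lcell).

Definition lcell_of a (T : filling a) (u : cell a) : lcell :=
  LCell (tag u) (tagged u) (entry T (tag u) (tagged u)).

Definition attacking p q : bool :=
  (lent p == lent q) &&
  [|| (lcol p == lcol q) && (lrow p != lrow q),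
      (lcol q == (lcol p).+1) && (lrow q < lrow p)
    | (lcol p == (lcol q).+1) && (lrow p < lrow q)].

(* Among equal entries, the one further right is the smaller. *)
Definition lent_lt p q : bool :=
  (lent p < lent q) || (lent p == lent q) && (lcol q < lcol p).

(* In both types p and q are the left and right cells of row r, and g is the  *)
(* third cell, so that their entries are alpha, beta and gamma.               *)
Definition typeI a p q g : bool :=
  [&& lrow q == lrow p, lcol q == (lcol p).+1, lcol g == lcol p,
      lrow p < lrow g & a (lrow g) < a (lrow p)].

Definition typeII a p q g : bool :=
  [&& lrow q == lrow p, lcol q == (lcol p).+1, lcol g == lcol q,
      lrow g < lrow p & a (lrow g) <= a (lrow p)].

Definition coinv p q g : bool :=
  [|| lent_lt p q && lent_lt q g,
      lent_lt q g && lent_lt g p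
    | lent_lt g p && lent_lt p q].

Definition coinvI a p q g := typeI a p q g && coinv p q g.
Definition coinvII a p q g := typeII a p q g && coinv p q g.

Definition nonattacking a (T : filling a) : bool :=
  [forall u : cell a, forall v : cell a,
     ~~ attacking (lcell_of T u) (lcell_of T v)].

Definition coinv_free a (T : filling a) : bool :=
  [forall u : cell a, forall v : cell a, forall w : cell a,
     ~~ (coinvI a (lcell_of T u) (lcell_of T v) (lcell_of T w)
         || coinvII a (lcell_of T u) (lcell_of T v) (lcell_of T w))].

Definition SSKD a : {set filling a} := [set T | nonattacking T && coinv_free T].

End Tableaux.

Section Operators.
Variable n : nat.
Implicit Types (a : weak_comp n.+2) (i k : nat).

(* There are n.+2 rows, so that the number of rows is arbitrary but >= 2; the *)
(* row numbered k, for 1 <= k <= n.+2, is the ordinal of value k - 1.         *)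
Definition row_no k : 'I_n.+2 := inord k.-1.

Definition sact i a : weak_comp n.+2 :=
  if i == 0 then
    [ffun r => if r == row_no 1 then (a (row_no n.+2)).+1
               else if r == row_no n.+2 then (a (row_no 1)).-1
               else a r]
  else
    [ffun r => if r == row_no i then a (row_no i.+1)
               else if r == row_no i.+1 then a (row_no i)
               else a r].

Section Positive.
Variables (i : nat) (a : weak_comp n.+2) (T : filling a).

Let y k := entry T (row_no i.+1) k.
Let x k := entry T (row_no i) k.

(* Entries in rows i+1 and i, in this order, of column k of the image. *)
Fixpoint Epos_col k : 'I_n.+2 * 'I_n.+2 :=
  if k is k'.+1 then
    let bad l z w := coinvII (sact i a) (LCell (row_no i.+1) k' l)
                       (LCell (row_no i.+1) k z) (LCell (row_no i) k w) in
    if (Epos_col k').1 == y k' then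
      if bad (y k') (y k) (x k) then (x k, y k) else (y k, x k)
    else
      if bad (x k') (x k) (y k) then (y k, x k) else (x k, y k)
  else (y 0, x 0).

Definition Epos_entry (r : 'I_n.+2) (c : nat) : 'I_n.+2 :=
  if r == row_no i.+1 then
    if c <= a (row_no i.+1) then (Epos_col c).1 else x c
  else if r == row_no i then (Epos_col c).2
  else entry T r c.

End Positive.

Section Zero.
Variables (a : weak_comp n.+2) (T : filling a).

Let y k := entry T (row_no n.+2) k.
Let x k := entry T (row_no 1) k.

(* Entries of the image in row n.+2, column k and in row 1, column k.+1,      *)
(* which are placed in the same step; y 0 is the basement entry of row n.+2.  *)
Fixpoint Ezero_col k : 'I_n.+2 * 'I_n.+2 :=
  if k is k'.+1 then
    let u := (Ezero_col k').2 in
    let bad z w :=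
      let p := LCell (row_no 1) k u in
      let q := LCell (row_no 1) k.+1 w in
      let g := LCell (row_no n.+2) k z in
      [|| coinvI (sact 0 a) p q g, attacking p q, attacking p g
        | attacking q g] in
    if u == x k then
      if bad (y k) (x k.+1) then (x k.+1, y k) else (y k, x k.+1)
    else
      if bad (x k.+1) (y k) then (y k, x k.+1) else (x k.+1, y k)
  else (y 0, x 1).

Definition Ezero_entry (r : 'I_n.+2) (c : nat) : 'I_n.+2 :=
  if r == row_no 1 then
    if c <= a (row_no 1) then (Ezero_col c.-1).2 else y c.-1
  else if r == row_no n.+2 then (Ezero_col c).1
  else entry T r c.

End Zero.

Definition E_op i a (T : filling a) : filling (sact i a) :=
  [ffun r : 'I_n.+2 =>
     [tuple (if i == 0 then Ezero_entry T r c.+1 else Epos_entry i T r c.+1)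
       | c < sact i a r]].

End Operators.

Arguments row_no {n} k.

(* Main.v *)
Require Import Defs.
From mathcomp Require Import all_boot.
From mathcomp Require Import zify.

Set Implicit Arguments.
Unset Strict Implicit.
Unset Printing Implicit Defensive.

(** A pair of rows l below u forms triples of one type only, and "no attacking
pair, no co-inversion triple" between them says that for each such triple (p, q, g),
going cyclically down from p one meets q strictly before g.  The entries of
column k+1 of the two rows rewritten by E_i are then forced by the upper entry
of column k, so everything reduces to triples with one further row s.  If s is
at most as long as the shorter of the two rows, or longer than the longer one,
these are checked column by column; for intermediate lengths one carries along
the invariant that an unswapped column reads s, y, x in cyclic descending
order.  Turning the diagram cyclically (row r + n in column c is row r in
column c + 1) preserves the conditions; it reduces rows s above to rows s
below, and E_0 to the case of two adjacent rows, row 1 being placed on top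
of row n. *)

(* Going cyclically down from p (included), q is met strictly before g. *)
Definition dn (p q g : nat) : bool :=
  [|| g < q <= p, q <= p < g | p < g < q].

(** Of the two ways to place two distinct entries, exactly one is admissible; this is what makes
    each step of the operators succeed. *)
Lemma dnC p q g : q != g -> dn p g q = ~~ dn p q g.
Proof. rewrite /dn; lia. Qed.

(* For a lower row l of length al and an upper row u of length au. *)
Definition rows_ok (al au : nat) (l u : nat -> nat) : Prop :=
  if au < al then forall c, c <= au -> dn (l c) (l c.+1) (u c)
  else forall c, c < al -> dn (u c) (u c.+1) (l c.+1).

Lemma eq_rows_ok al au l l' u u' :
  (forall c, c <= al -> l c = l' c) -> (forall c, c <= au -> u c = u' c) ->
  rows_ok al au l u -> rows_ok al au l' u'.
Proof.
rewrite /rows_ok => el eu; case: ifPn => lt H c hc; have := H c hc.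
  by rewrite !el ?eu //; lia.
by rewrite !eu ?el //; lia.
Qed.

(** The turn of the diagram: [l] leaves its place below [u] and reappears above it, one column to
    the left. Type II triples become Type I triples; Type I triples become Type II triples with
    index lowered by one. The one left over, at column 0, has [p = q] and holds because
    [l 0 != u 0]. *)
Lemma rows_ok_shift al au l u : l 0 = l 1 -> l 0 != u 0 ->
  rows_ok al.+1 au l u <-> rows_ok au al u (fun c => l c.+1).
Proof.
rewrite /rows_ok ltnS leqNgt => l01 lu0.
case: (ltnP al au) => h /=; first by [].
split=> H c hc; first exact: H.
by case: c hc => [|c] hc; [rewrite -l01; move: lu0; rewrite /dn; lia|exact: H].
Qed.

(* x and y are the lower and upper of the two rows rewritten by E_i (of lengths B and
A, with A < B), L and U their images, U being continued by x beyond column A. *)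
Section Straightening.
Variables (A : nat) (x y U L : nat -> nat).
Hypothesis perm : forall k, k <= A ->
  U k = y k /\ L k = x k \/ U k = x k /\ L k = y k.
Hypothesis step : forall k, k < A -> dn (U k) (U k.+1) (L k.+1).
Hypothesis xy : forall k, k <= A -> dn (x k) (x k.+1) (y k).

Let Ux k := if k <= A then U k else x k.

(** * A lower third row, longer than [y] but not longer than [x] *)

Section Medium.
Variables (l : nat) (s : nat -> nat).
Hypothesis A_lt_l : A < l.
Hypothesis s0 : dn (s 0) (y 0) (x 0).
Hypothesis sy : forall k, k <= A -> dn (s k) (s k.+1) (y k).
Hypothesis xs : forall k, k < l -> dn (x k) (x k.+1) (s k.+1).

Lemma medium_inv k : k <= A -> U k = y k -> dn (s k) (y k) (x k).
Proof.
elim: k => [//|k IH] kA Uy.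
have := IH (ltnW kA); have := sy (ltnW kA); have := xs (ltn_trans kA A_lt_l).
have := xy (ltnW kA); have := xy kA; have := step kA; rewrite Uy.
have [[-> _]|[-> _]] := perm (ltnW kA); case: (perm kA) => -[Ue ->].
all: rewrite Uy in Ue; rewrite ?Ue /dn; lia.
Qed.

(** In a swapped column this is [sy]. In an unswapped one, going down from [s k], one meets
    [s k.+1], then [y k], then [x k] by the invariant. *)
Lemma medium_lower k : k <= A -> dn (s k) (s k.+1) (L k).
Proof.
move=> kA; have := medium_inv kA; have := sy kA; have := xs (leq_ltn_trans kA A_lt_l).
have := xy kA; have [[-> ->]|[-> ->]] := perm kA; rewrite /dn; lia.
Qed.

Lemma medium_upper k : k < l -> dn (Ux k) (Ux k.+1) (s k.+1).
Proof.
move=> kl; rewrite /Ux; have := xs kl.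
case: (ltngtP k A) => [kA|//|->].
- have := medium_inv kA; have := medium_inv (ltnW kA); have := sy (ltnW kA).
  have := xy (ltnW kA); have := xy kA; have := step kA.
  have [[-> _]|[-> _]] := perm (ltnW kA);
    have [[-> ->]|[-> ->]] := perm kA; rewrite /dn; lia.
(* At [k = A] the row passes from [U A] to [x A.+1], so [step] gives nothing and the invariant at
   [A] takes its place. *)
- have := medium_inv (leqnn A); have := sy (leqnn A).
  have := xy (leqnn A).
  have [[-> _]|[-> _]] := perm (leqnn A); rewrite /dn; lia.
Qed.
End Medium.

(** * A lower third row not longer than [y] *)

Section Short.
Variables (l : nat) (s : nat -> nat).
Hypothesis l_le_A : l <= A.
Hypothesis xs : forall k, k < l -> dn (x k) (x k.+1) (s k.+1).
Hypothesis ys : forall k, k < l -> dn (y k) (y k.+1) (s k.+1).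

(** If exactly one of the columns [k], [k.+1] is swapped, [step] and [xy] fix the cyclic order of
    the four entries, and [xs], [ys] then confine [s k.+1] to the arc where both claims hold. *)
Lemma short_rows k : k < l ->
  dn (U k) (U k.+1) (s k.+1) /\ dn (L k) (L k.+1) (s k.+1).
Proof.
move=> kl; have kA : k < A by exact: leq_trans kl l_le_A.
have := xs kl; have := ys kl; have := xy (ltnW kA); have := step kA.
have [[-> ->]|[-> ->]] := perm (ltnW kA).
all: by have [[-> ->]|[-> ->]] := perm kA; rewrite /dn; lia.
Qed.
End Short.

(** * Third rows of every length, below or above *)

Variable B : nat.
Hypothesis AB : A < B.

Lemma straightened_rows : rows_ok A B L Ux.
Proof.
rewrite /rows_ok ltnNge (ltnW AB) /= => c hc; rewrite /Ux hc (ltnW hc).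
exact: step.
Qed.

Lemma straightened_below l s : dn (s 0) (y 0) (x 0) ->
  rows_ok l B s x -> rows_ok l A s y -> rows_ok l B s Ux /\ rows_ok l A s L.
Proof.
rewrite /rows_ok => s0; case: (ltnP B l) => [Bl|lB] sx.
  rewrite (ltn_trans AB Bl) => sy; split=> c hc.
    rewrite /Ux; case: leqP => cA; last exact: sx.
    by case: (perm cA) => -[-> _]; [exact: sy|exact: sx].
  by case: (perm hc) => -[_ ->]; [apply: sx; lia|exact: sy].
case: (ltnP A l) => [Al|lA] sy.
  by split=> c hc; [exact: medium_upper sx c hc|exact: medium_lower sx c hc].
split=> c hc; have [] := short_rows lA sx sy hc => //.
by rewrite /Ux (leq_trans hc lA) (ltnW (leq_trans hc lA)).
Qed.

Lemma straightened_above l s : s 0 != y 0 -> dn (s 0) (y 0) (x 0) ->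
  rows_ok B l x s -> rows_ok A l y s -> rows_ok B l Ux s /\ rows_ok A l L s.
Proof.
(* [t] is [s] turned to the bottom: truncated predecessor makes columns 0 and 1 both equal to [s 0],
   as [rows_ok_shift] requires. *)
move=> sy0 s0 xs ys; pose t c := s c.-1.
have nz (z : nat -> nat) : z 0 = y 0 \/ z 0 = x 0 -> t 0 != z 0.
  by move: s0; rewrite /t /dn /= => ? [] -> //; lia.
have sh (z : nat -> nat) m : z 0 = y 0 \/ z 0 = x 0 ->
    rows_ok l.+1 m t z <-> rows_ok m l z s.
  by move=> zE; apply: rows_ok_shift => //; exact: nz.
have P0 := perm (leq0n A).
have U0 : Ux 0 = y 0 \/ Ux 0 = x 0 by rewrite /Ux; tauto.
have L0 : L 0 = y 0 \/ L 0 = x 0 by tauto.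
rewrite -!sh //; apply: straightened_below => //; rewrite sh //; tauto.
Qed.
End Straightening.

(** * Tableaux described by pairs of rows *)

Section Characterization.
Variables (n : nat) (a : weak_comp n) (T : filling a).

Definition cell_at (r : 'I_n) c (h : c < (a r).+1) : cell a :=
  Tagged (fun r : 'I_n => 'I_(a r).+1) (Ordinal h).

(** The tie rule makes [p] larger than an equal entry in column [c.+1], in agreement with [dn]. Only
    a tie of [p] with [g] in the same column [c] has to be excluded. *)
Lemma coinvE (r1 r2 r3 : 'I_n) c d (p q g : 'I_n) : q != g -> p != g \/ d = c.+1 ->
  d \in [:: c; c.+1] ->
  coinv (LCell r1 c p) (LCell r2 c.+1 q) (LCell r3 d g) = ~~ dn p q g.
Proof.
rewrite !inE /coinv /lent_lt /dn /= -!val_eqE /=; lia.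
Qed.

(** Outside the basement, whose entries are distinct, every pair of cells that could attack lies in
    a triple of its two rows and includes the cell [g]. Since [dn] fails when [g] ties with [p] or
    [q], it rules out attacks as well as co-inversions. *)
Lemma SSKDP : reflect
  (forall l u : 'I_n, l < u -> rows_ok (a l) (a u) (entry T l) (entry T u))
  (T \in SSKD a).
Proof.
rewrite inE; apply: (iffP andP) => [[/forallP na /forallP cf] l u lu|rows].
  have NA (r s : 'I_n) c d (hc : c < (a r).+1) (hd : d < (a s).+1) :
      ~~ attacking (LCell r c (entry T r c)) (LCell s d (entry T s d)).
    by have /forallP/(_ (cell_at hd)) := na (cell_at hc).
  have CF (r s : 'I_n) c d (hc : c < a r) (hd : d < (a s).+1) :
      let p := LCell r c (entry T r c) in
      let q := LCell r c.+1 (entry T r c.+1) in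
      let g := LCell s d (entry T s d) in
      ~~ (coinvI a p q g || coinvII a p q g).
    have /forallP/(_ (cell_at (hc : c.+1 < (a r).+1)))/forallP/(_ (cell_at hd)) :=
      cf (cell_at (ltnW hc : c < (a r).+1)).
    by [].
  rewrite /rows_ok; case: ltnP => alu c hc.
    have cl : c < a l by exact: leq_ltn_trans hc alu.
    have := CF l u c c cl hc; have := NA l u c c (ltnW cl) hc.
    have := NA l u c.+1 c cl hc.
    rewrite /coinvI /typeI /coinvII /typeII /attacking /= !eqxx lu alu /= => h1 h2.
    rewrite coinvE ?inE ?eqxx //; move: h1 h2; rewrite -!val_eqE /=; lia.
  have cu : c < a u by exact: leq_trans hc alu.
  have := CF u l c c.+1 cu hc; have := NA u l c.+1 c.+1 cu hc.
  have := NA u l c c.+1 (ltnW cu) hc.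
  rewrite /coinvI /typeI /coinvII /typeII /attacking /= !eqxx lu alu /= => h1 h2.
  rewrite coinvE ?inE ?eqxx ?orbT //; move: h1 h2; rewrite -?val_eqE /=; lia.
have same (l u : 'I_n) c : l < u -> c <= a l -> c <= a u -> entry T l c != entry T u c.
  move=> lu cl cu; have := rows _ _ lu; rewrite /rows_ok -val_eqE.
  case: ltnP => [_ /(_ _ cu)|_].
    rewrite /dn /=; lia.
  by case: c cl cu => [|c] cl cu; [rewrite /entry /=|move=> /(_ _ cl); rewrite /dn /=]; lia.
have adj (l u : 'I_n) c : l < u -> c < a l -> c <= a u -> entry T u c != entry T l c.+1.
  move=> lu cl cu; have := rows _ _ lu; rewrite /rows_ok -val_eqE.
  by case: ltnP => [_ /(_ _ cu)|_ /(_ _ cl)]; rewrite /dn /=; lia.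
split.
  apply/forallP => -[r [c hc]]; apply/forallP => -[s [d hd]].
  rewrite /lcell_of /attacking /=; apply/negP => /andP[/eqP e].
  case/or3P => /andP[/eqP E rs].
  - subst d; move: rs; rewrite -val_eqE neq_ltn => /orP[] rs.
      by have := same _ _ c rs hc hd; rewrite e eqxx.
    by have := same _ _ c rs hd hc; rewrite e eqxx.
  - by subst d; have := adj _ _ c rs hd hc; rewrite e eqxx.
  - by subst c; have := adj _ _ d rs hc hd; rewrite e eqxx.
apply/forallP => -[r [c hc]]; apply/forallP => -[r' [c' hc']].
apply/forallP => -[s [d hd]]; rewrite /lcell_of /=; apply/negP.
case/orP => /andP[/and5P[/= /eqP E1 /eqP E2 /eqP E3 rs alu]].
  subst r' c' d; have := rows _ _ rs; rewrite /rows_ok alu => /(_ _ hd) D.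
  by rewrite coinvE ?D ?inE ?eqxx //; move: D; rewrite -!val_eqE /dn /=; lia.
subst r' c' d; have := rows _ _ rs; rewrite /rows_ok ltnNge alu => /(_ _ hd) D.
by rewrite coinvE ?D ?inE ?eqxx ?orbT //; move: D; rewrite -?val_eqE /dn /=; lia.
Qed.

End Characterization.

Section Operators.
Variables (n : nat).
Implicit Types (i k : nat) (a : weak_comp n.+2).

Lemma row_noE k : k <= n.+2 -> (row_no k : 'I_n.+2) = k.-1 :> nat.
Proof. by move=> h; rewrite /row_no /= inordK //; lia. Qed.

Lemma entry_E_op i a (T : filling a) r c : c <= sact i a r ->
  entry (E_op i T) r c =
  if c is 0 then r else if i == 0 then Ezero_entry T r c else Epos_entry i T r c.
Proof.
case: c => [//|c] hc; rewrite /entry /= -[c]/(val (Ordinal hc)) -tnth_nth.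
by rewrite ffunE tnth_mktuple.
Qed.

(** * The operators with positive index *)

Section Positive.
Variables (i : nat) (a : weak_comp n.+2) (T : filling a).
Hypothesis ai : a (row_no i.+1) < a (row_no i).
Hypotheses (i0 : 0 < i) (hi : i < n.+2).
Hypothesis hT : T \in SSKD a.

Local Notation lo := (row_no i : 'I_n.+2).
Local Notation up := (row_no i.+1 : 'I_n.+2).
Let x k : nat := entry T lo k.
Let y k : nat := entry T up k.
Let U k : nat := (Epos_col i T k).1.
Let L k : nat := (Epos_col i T k).2.

Lemma lo_lt_up : lo < up.
Proof. by rewrite !row_noE; lia. Qed.

Lemma Epos_xy : rows_ok (a lo) (a up) x y.
Proof. by have /SSKDP := hT; apply; exact: lo_lt_up. Qed.

Lemma Epos_perm k : U k = y k /\ L k = x k \/ U k = x k /\ L k = y k.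
Proof.
rewrite /U /L; case: k => [|k]; first by left.
by rewrite /=; do 2 case: ifP => _; rewrite /=; auto.
Qed.

Lemma Epos_step k : k < a up -> dn (U k) (U k.+1) (L k.+1).
Proof.
move=> ku; have := Epos_xy; rewrite /rows_ok ai => D.
have yx : entry T up k.+1 != entry T lo k.+1.
  by have := D _ ku; rewrite /dn /x /y -val_eqE /=; lia.
have cE (r1 r2 r3 : 'I_n.+2) (p q g : 'I_n.+2) : q != g ->
  coinv (LCell r1 k p) (LCell r2 k.+1 q) (LCell r3 k.+1 g) = ~~ dn p q g.
  by move=> qg; rewrite coinvE ?inE ?eqxx ?orbT //; right.
have uplo : (up == lo) = false by rewrite -val_eqE /= eqn_leq leqNgt lo_lt_up.
have tE (p q g : 'I_n.+2) :
    typeII (sact i a) (LCell up k p) (LCell up k.+1 q) (LCell lo k.+1 g).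
  rewrite /typeII /= !eqxx lo_lt_up /sact eqn0Ngt i0 /= !ffunE !eqxx uplo.
  exact: ltnW ai.
have xy : entry T lo k.+1 != entry T up k.+1 by rewrite eq_sym.
rewrite /U /L /= /coinvII !tE !cE //=; case: eqP => [->|ne].
  by case: ifP => [bad|/negbFE] //=; rewrite dnC.
have -> : (Epos_col i T k).1 = entry T lo k.
  by have [[/val_inj]|[/val_inj]] := Epos_perm k.
by case: ifP => [bad|/negbFE] //=; rewrite dnC.
Qed.

Lemma E_op_pos : E_op i T \in SSKD (sact i a).
Proof.
have loup := lo_lt_up; have rows := elimT (SSKDP T) hT.
have iE : (i == 0) = false by rewrite eqn0Ngt i0.
have uplo : (up == lo) = false by rewrite -val_eqE /= eqn_leq leqNgt loup.
have sE r : sact i a r = if r == lo then a up else if r == up then a lo else a r.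
  by rewrite /sact iE ffunE.
pose Ux k := if k <= a up then U k else x k.
have lowE c : c <= sact i a lo -> L c = entry (E_op i T) lo c.
  move=> hc; rewrite entry_E_op // iE; case: c {hc} => // c.
  by rewrite /Epos_entry eq_sym uplo eqxx.
have upE c : c <= sact i a up -> Ux c = entry (E_op i T) up c.
  move=> hc; rewrite entry_E_op // iE; case: c {hc} => // c.
  by rewrite /Epos_entry eqxx /Ux /U /x; case: ifP.
have otherE r : r != lo -> r != up -> forall c, c <= sact i a r ->
    entry T r c = entry (E_op i T) r c :> nat.
  move=> rl ru c hc; rewrite entry_E_op // iE; case: c {hc} => // c.
  by rewrite /Epos_entry (negbTE rl) (negbTE ru).
apply/SSKDP => l u lu.
have lE : l = lo \/ l = up \/ l != lo /\ l != up by do 2 case: eqP; auto.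
have uE : u = lo \/ u = up \/ u != lo /\ u != up by do 2 case: eqP; auto.
have perm k : k <= a up -> U k = y k /\ L k = x k \/ U k = x k /\ L k = y k.
  by move=> _; exact: Epos_perm.
have xy k : k <= a up -> dn (x k) (x k.+1) (y k).
  by have := Epos_xy; rewrite /rows_ok ai; apply.
have below (s : 'I_n.+2) : s < lo ->
    rows_ok (a s) (a lo) (entry T s) Ux /\ rows_ok (a s) (a up) (entry T s) L.
  move=> slo; have sup := ltn_trans slo loup.
  apply: (straightened_below perm Epos_step xy ai); [|exact: rows..].
  by rewrite /x /y /entry /dn /=; lia.
have above (s : 'I_n.+2) : up < s ->
    rows_ok (a lo) (a s) Ux (entry T s) /\ rows_ok (a up) (a s) L (entry T s).
  move=> ups; have los := ltn_trans loup ups.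
  apply: (straightened_above perm Epos_step xy ai); [| |exact: rows..].
    by rewrite /y /entry /= gtn_eqF.
  by rewrite /x /y /entry /dn /=; lia.
have lo_up := straightened_rows x Epos_step ai.
have [lenlo lenup] : sact i a lo = a up /\ sact i a up = a lo.
  by rewrite !sE eqxx uplo eqxx.
have len r : r != lo -> r != up -> sact i a r = a r.
  by rewrite sE => /negbTE-> /negbTE->.
(* The two rewritten rows are consecutive, so any other row lies below both or above both. *)
have btw (r : 'I_n.+2) : r != lo -> r != up ->
    (r < lo) = (r < up) /\ (lo < r) = (up < r).
  by rewrite -!val_eqE /= !row_noE; lia.
case: lE => [E|[E|[ll lu']]]; case: uE => [E'|[E'|[ul uu]]]; subst.
all: try by move: lu; rewrite ?ltnn // ltnNge ltnW.
- by apply: (eq_rows_ok lowE upE); rewrite lenlo lenup.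
- apply: (eq_rows_ok lowE (otherE _ ul uu)); rewrite lenlo len //.
  by have [] := above u; rewrite // -(btw u ul uu).2.
- apply: (eq_rows_ok upE (otherE _ ul uu)); rewrite lenup len //.
  by have [] := above u.
- apply: (eq_rows_ok (otherE _ ll lu') lowE); rewrite lenlo len //.
  by have [] := below l.
- apply: (eq_rows_ok (otherE _ ll lu') upE); rewrite lenup len //.
  by have [] := below l; rewrite // (btw l ll lu').1.
- apply: (eq_rows_ok (otherE _ ll lu') (otherE _ ul uu)); rewrite !len //.
  exact: rows.
Qed.
End Positive.

(** * The operator of index 0, by way of the turned diagram *)

Section Zero.
Variables (a : weak_comp n.+2) (T : filling a).
Local Notation bot := (row_no 1 : 'I_n.+2).
Local Notation top := (row_no n.+2 : 'I_n.+2).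
Hypotheses (bot_gt0 : 0 < a bot) (bot_top : a bot <= a top).
Hypothesis hT : T \in SSKD a.

Let A := (a bot).-1.
(* Row 1, shifted by one column, is regarded as lying above row n. *)
Let x k : nat := entry T top k.
Let y k : nat := entry T bot k.+1.
Let U k : nat := (Ezero_col T k).2.
Let L k : nat := (Ezero_col T k).1.

Lemma botE : bot = 0 :> nat. Proof. by rewrite row_noE. Qed.
Lemma topE : top = n.+1 :> nat. Proof. by rewrite row_noE. Qed.

(** A larger entry [e] here would be attacked by the basement cell of the higher row [e]. *)
Lemma bot1 : entry T bot 1 = bot.
Proof.
set e := entry T bot 1; have e0 : entry T e 0 = e by [].
apply/eqP; rewrite -val_eqE /= botE eqn0Ngt; apply/negP => lt.
have /SSKDP/(_ bot e) := hT; rewrite botE => /(_ lt).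
by rewrite /rows_ok; case: ltnP => _ /(_ 0); rewrite -/e e0 /dn; lia.
Qed.

Lemma Ezero_rows (s : 'I_n.+2) : bot < s ->
  rows_ok (a s) A (entry T s) y.
Proof.
move=> bs; have /SSKDP/(_ _ _ bs) := hT.
rewrite -{1}(prednK bot_gt0) rows_ok_shift //; first by rewrite bot1.
by rewrite /entry /= ltn_eqF.
Qed.

Lemma Ezero_xy k : k <= A -> dn (x k) (x k.+1) (y k).
Proof.
have := @Ezero_rows top; rewrite botE topE /rows_ok => /(_ isT).
by have -> : A < a top by [rewrite /A; lia]; apply.
Qed.

(** The letters are exchanged with respect to [Ezero_col]: its [y k] is [x k] here, and its [x k.+1]
    is [y k]. *)
Lemma Ezero_perm k : U k = y k /\ L k = x k \/ U k = x k /\ L k = y k.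
Proof.
rewrite /U /L; case: k => [|k]; first by left.
by rewrite /=; do 2 case: ifP => _; rewrite /=; auto.
Qed.

Lemma Ezero_step k : k < A -> dn (U k) (U k.+1) (L k.+1).
Proof.
move=> ku.
have yx : entry T bot k.+2 != entry T top k.+1.
  by have := Ezero_xy ku; rewrite /dn /x /y -val_eqE /=; lia.
have bt : bot < top by rewrite botE topE.
have tb : (top == bot) = false by rewrite -val_eqE /= gtn_eqF.
(* The attack clauses catch the ties of [z] with [u] or [w], where [dn] fails too; without such ties
   [coinvE] applies. *)
have badE (u z w : 'I_n.+2) :
    let p := LCell bot k.+1 u in let q := LCell bot k.+2 w in
    let g := LCell top k.+1 z in
    [|| coinvI (sact 0 a) p q g, attacking p q, attacking p g | attacking q g]
    = ~~ dn u w z.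
  rewrite /= /coinvI /typeI /attacking /= !eqxx bt /sact /= !ffunE !eqxx tb.
  have -> : (a bot).-1 < (a top).+1 by lia.
  have [->|wz] := eqVneq w z; first by rewrite !orbT /dn; lia.
  have [->|uz] := eqVneq u z.
    by rewrite [bot == top]eq_sym tb !orbT /dn; move: wz; rewrite -val_eqE /=; lia.
  by rewrite coinvE ?inE ?eqxx //=; [rewrite !ltnn !andbF !orbF|left].
have xy : entry T top k.+1 != entry T bot k.+2 by rewrite eq_sym.
rewrite /U /L /= !badE; case: eqP => [->|ne].
  by case: ifP => [bad|/negbFE] //=; rewrite dnC.
have -> : (Ezero_col T k).2 = entry T top k.
  by have [[/val_inj]|[/val_inj]] := Ezero_perm k.
by case: ifP => [bad|/negbFE] //=; rewrite dnC.
Qed.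

Lemma E_op_zero : E_op 0 T \in SSKD (sact 0 a).
Proof.
have bt : bot < top by rewrite botE topE.
have tb : (top == bot) = false by rewrite -val_eqE /= gtn_eqF.
have AB : A < a top by rewrite /A; lia.
pose Ux k := if k <= A then U k else x k.
pose low k : nat := if k is k'.+1 then Ux k' else bot.
have [lenbot lentop] : sact 0 a bot = (a top).+1 /\ sact 0 a top = A.
  by rewrite /sact /= !ffunE eqxx tb eqxx.
have len r : r != bot -> r != top -> sact 0 a r = a r.
  by rewrite /sact /= ffunE => /negbTE-> /negbTE->.
have botentry c : c <= sact 0 a bot -> low c = entry (E_op 0 T) bot c.
  move=> hc; rewrite entry_E_op //; case: c {hc} => // c.
  rewrite eqxx /Ezero_entry eqxx -[in RHS](ltn_predK bot_gt0) ltnS.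
  by rewrite /low /Ux /U /x /A; case: ifP.
have topentry c : c <= sact 0 a top -> L c = entry (E_op 0 T) top c.
  move=> hc; rewrite entry_E_op //; case: c {hc} => // c.
  by rewrite eqxx /Ezero_entry tb eqxx.
have otherentry r : r != bot -> r != top -> forall c, c <= sact 0 a r ->
    entry T r c = entry (E_op 0 T) r c :> nat.
  move=> rb rt c hc; rewrite entry_E_op //; case: c {hc} => // c.
  by rewrite eqxx /Ezero_entry (negbTE rb) (negbTE rt).
have perm k : k <= A -> U k = y k /\ L k = x k \/ U k = x k /\ L k = y k.
  by move=> _; exact: Ezero_perm.
have rows := elimT (SSKDP T) hT.
(* After the turn all other rows lie below the two rewritten ones, so no case of a row above
   arises. *)
have below (s : 'I_n.+2) : bot < s -> s < top ->
    rows_ok (a s) (a top) (entry T s) Ux /\ rows_ok (a s) A (entry T s) L.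
  move=> bs st; apply: (straightened_below perm Ezero_step Ezero_xy AB).
  - by rewrite /x /y bot1 botE /entry /dn /=; lia.
  - exact: rows.
  - exact: Ezero_rows.
(* Turning back: row 1 of the image starts with its basement entry repeated in column 1, because
   [U 0 = y 0] equals [bot] by [bot1]. *)
have shift au u : 0 < u 0 -> rows_ok au (a top) u Ux -> rows_ok (a top).+1 au low u.
  by move=> u0 H; apply/rows_ok_shift; rewrite //= ?botE ?ltn_eqF // /Ux /U /= bot1 botE.
have other r : r != bot -> r != top -> bot < r < top.
  by rewrite -!val_eqE /= botE topE; have := ltn_ord r; lia.
apply/SSKDP => l u lu.
have lE : l = bot \/ l = top \/ l != bot /\ l != top by do 2 case: eqP; auto.
have uE : u = bot \/ u = top \/ u != bot /\ u != top by do 2 case: eqP; auto.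
case: lE => [E|[E|[lb lt]]]; case: uE => [E'|[E'|[ub ut]]]; subst.
all: try by move: lu; rewrite ?botE ?topE; try have := ltn_ord u; lia.
- apply: (eq_rows_ok botentry topentry); rewrite lenbot lentop.
  apply: shift; first by rewrite /L /= topE.
  exact: (straightened_rows x Ezero_step AB).
- apply: (eq_rows_ok botentry (otherentry _ ub ut)); rewrite lenbot len //.
  have /andP[bu ut'] := other u ub ut.
  by apply: shift; [move: bu; rewrite botE|have [] := below u bu ut'].
- apply: (eq_rows_ok (otherentry _ lb lt) topentry); rewrite lentop len //.
  by have /andP[bl lt'] := other l lb lt; have [] := below l bl lt'.
- apply: (eq_rows_ok (otherentry _ lb lt) (otherentry _ ub ut)); rewrite !len //.
  exact: rows.
Qed.
End Zero.
End Operators.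

Theorem theorem4p5 (n i : nat) (hi : i < n.+2) (a : weak_comp n.+2)
    (hpos : 1 <= i -> a (row_no i.+1) < a (row_no i))
    (hzero : i = 0 -> 0 < a (row_no 1) <= a (row_no n.+2))
    (T : filling a) (hT : T \in SSKD a) :
  E_op i T \in SSKD (sact i a).
Proof.
case: i => [|i] in hi hpos hzero *; last exact: E_op_pos (hpos isT) _ hi hT.
by have /andP[] := hzero erefl; move=> ? ?; exact: E_op_zero.
Qed.
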